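(* Let $G$ and $H$ be Hilbert spaces, let $S:G\to H$ be a linear isomorphism, and let $F\subset G$ be a quasi-normed space such that the embedding $F\hookrightarrow G$ is compact. Then for all $C\ge1$ and all $n\in\mathbb N$, $$ e^{\rm cont}_{4n+1}(S,F,H)\le 2C\,\|S\|^2\,\|S^{-1}\|^2\, e^{\rm non}_{n,C}(S,F,H). $$
   Context: For a map $S_n:F\to H$, $e(S_n,F,H)=\sup_{\|f\|_F\le1}\|Sf-S_n(f)\|_H$. Manifold widths: $e^{\rm cont}_n(S,F,H)=\inf e(\varphi_n\circ N_n,F,H)$ over all continuous $N_n:F\to\mathbb R^n$ and continuous $\varphi_n:\mathbb R^n\to H$. A sequence $\mathcal B=\{h_1,h_2,\dots\}\subset H$ is a Riesz basis if finite linear combinations are dense and $A(\sum|\alpha_k|^2)^{1/2}\le\|\sum\alpha_kh_k\|_H\le B(\sum|\alpha_k|^2)^{1/2}$ for all finitely supported sequences, with $A,B$ the optimal constants; $\mathcal B_C$ is the set of Riesz bases of $H$ with $B/A\le C$. $\sigma_n(u,\mathcal B)_H=\inf_{i_1,\dots,i_n}\inf_{c_1,\dots,c_n}\|u-\sum_{k=1}^nc_kh_{i_k}\|_H$. Nonlinear widths: $e^{\rm non}_{n,C}(S,F,H)=\inf_{\mathcal B\in\mathcal B_C}\sup_{\|f\|_F\le1}\sigma_n(Sf,\mathcal B)_H$ (equivalently, infimum over $\mathcal B\in\mathcal B_C$ and over arbitrary maps $S_n(f)=\sum_{k=1}^nc_kh_{i_k}$ with $c_k,i_k$ depending arbitrarily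 on $f$, of $e(S_n,F,H)$). *)

(* Defs.v *)
From HB Require Import structures.
From mathcomp Require Import all_boot all_order all_algebra.
From mathcomp Require Import all_classical all_reals all_analysis.
Set Implicit Arguments. Unset Strict Implicit. Unset Printing Implicit Defensive.
Import Order.TTheory GRing.Theory Num.Theory.
Import numFieldNormedType.Exports.
Local Open Scope classical_set_scope.
Local Open Scope ring_scope.

(* A (real) Hilbert space is a complete normed space whose norm comes from
   an inner product ip: ip symmetric, linear in the first argument, and
   ip x x = |x|^2 (hence positive definite). *)
Definition inner_product (R : realType) (V : normedModType R)
    (ip : V -> V -> R) : Prop :=
  [/\ forall x y, ip x y = ip y x,
      forall (a : R) (x y z : V), ip (a *: x + y) z = a * ip x z + ip y z
    & forall x, ip x x = `|x| ^+ 2].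

(* F is given as a linear subspace Fs of G together with a quasi-norm q
   (only its values on Fs matter). *)
Definition quasi_normed_subspace (R : realType) (G : normedModType R)
    (Fs : set G) (q : G -> R) : Prop :=
  Fs 0 /\
  (forall x y, Fs x -> Fs y -> Fs (x + y)) /\
  (forall (a : R) x, Fs x -> Fs (a *: x)) /\
  (forall x, Fs x -> 0 <= q x) /\
  (forall x, Fs x -> q x = 0 -> x = 0) /\
  (forall (a : R) x, Fs x -> q (a *: x) = `|a| * q x) /\
  (exists K : R, 1 <= K /\
      forall x y, Fs x -> Fs y -> q (x + y) <= K * (q x + q y)).

Definition unit_ballF (R : realType) (G : normedModType R)
    (Fs : set G) (q : G -> R) : set G :=
  [set f | Fs f /\ q f <= 1].

Definition compact_embedding (R : realType) (G : normedModType R)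
    (Fs : set G) (q : G -> R) : Prop :=
  compact (closure (unit_ballF Fs q)).

Definition Fcontinuous (R : realType) (G : normedModType R)
    (Fs : set G) (q : G -> R) (m : nat) (N : G -> 'rV[R]_m) : Prop :=
  forall f, Fs f -> forall e : R, 0 < e -> exists2 d : R, 0 < d &
    forall g, Fs g -> q (g - f) < d -> `|N g - N f| < e.

Definition op_norm (R : realType) (V W : normedModType R) (T : V -> W) : \bar R :=
  ereal_sup [set (`|T x|)%:E | x in [set x : V | `|x| <= 1]].

Definition err (R : realType) (G H : normedModType R)
    (Fs : set G) (q : G -> R) (S Sn : G -> H) : \bar R :=
  ereal_sup [set (`|S f - Sn f|)%:E | f in unit_ballF Fs q].

Definition e_cont (R : realType) (G H : normedModType R)
    (Fs : set G) (q : G -> R) (S : G -> H) (m : nat) : \bar R :=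
  ereal_inf [set x | exists (N : G -> 'rV[R]_m) (phi : 'rV[R]_m -> H),
               [/\ Fcontinuous Fs q N, continuous phi
                  & x = err Fs q S (phi \o N)]].

Definition lincomb (R : realType) (H : normedModType R)
    (h : nat -> H) (N : nat) (alpha : nat -> R) : H :=
  \sum_(k < N) alpha k *: h k.

Definition l2fin (R : realType) (N : nat) (alpha : nat -> R) : R :=
  Num.sqrt (\sum_(k < N) alpha k ^+ 2).

Definition complete_seq (R : realType) (H : normedModType R) (h : nat -> H) : Prop :=
  closure [set v | exists (N : nat) (alpha : nat -> R), v = lincomb h N alpha]
  = [set: H].

(* the ratios ||sum alpha_k h_k|| / ||alpha||_2 over nonzero finitely
   supported sequences; the optimal Riesz constants A, B are their inf and sup *)
Definition riesz_ratios (R : realType) (H : normedModType R) (h : nat -> H) : set (\bar R) :=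
  [set x | exists (N : nat) (alpha : nat -> R),
     (exists2 k, (k < N)%N & alpha k != 0) /\
     x = (`|lincomb h N alpha| / l2fin N alpha)%:E].

Definition riesz_A (R : realType) (H : normedModType R) (h : nat -> H) : \bar R :=
  ereal_inf (riesz_ratios h).
Definition riesz_B (R : realType) (H : normedModType R) (h : nat -> H) : \bar R :=
  ereal_sup (riesz_ratios h).

Definition riesz_basis (R : realType) (H : normedModType R) (h : nat -> H) : Prop :=
  [/\ complete_seq h, (0 < riesz_A h)%E & (riesz_B h < +oo)%E].

Definition riesz_C (R : realType) (H : normedModType R) (C : R) (h : nat -> H) : Prop :=
  riesz_basis h /\ (fine (riesz_B h) / fine (riesz_A h) <= C).

Definition sigma_n (R : realType) (H : normedModType R) (n : nat)
    (u : H) (h : nat -> H) : \bar R :=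
  ereal_inf [set x | exists (i : 'I_n -> nat) (c : 'I_n -> R),
               x = (`|u - \sum_(k < n) c k *: h (i k)|)%:E].

Definition e_non (R : realType) (G H : normedModType R)
    (Fs : set G) (q : G -> R) (S : G -> H) (n : nat) (C : R) : \bar R :=
  ereal_inf [set ereal_sup [set sigma_n n (S f) h | f in unit_ballF Fs q] |
               h in [set h : nat -> H | riesz_C C h]].

(* Main.v *)
Require Import Defs.
From HB Require Import structures.
From mathcomp Require Import all_boot all_order all_algebra.
From mathcomp Require Import all_classical all_reals all_analysis.
From mathcomp Require Import zify ring lra.
Import Order.TTheory GRing.Theory Num.Theory.
Import numFieldNormedType.Exports.
Local Open Scope classical_set_scope.
Local Open Scope ring_scope.

(* Let h be a Riesz basis with constants A, B, and let K be the compact image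
   under S of the closed unit ball of F.  A Schauder projection approximates K
   by finite combinations of the h_j whose coefficient vectors a depend
   continuously on the point.  Soft thresholding at the (2n+1)-st largest
   |a_j| is continuous, yields a 2n-sparse vector, and costs at most sqrt 2
   times the best n-term error in l2.  Since differences of 2n-sparse vectors
   are 4n-sparse, the first 4n+1 power moments (a Vandermonde map) are
   injective on 2n-sparse vectors, with a Lipschitz inverse, which extends to a
   continuous decoder on R^(4n+1).  This gives the bound with constant 2C; the
   remaining factors only help, as |S| |S^-1| >= 1 unless G = 0. *)

(** * Soft thresholding at an order statistic *)

Section Threshold.
Variables (R : realType) (N : nat).
Implicit Types (a : nat -> R) (T : {set 'I_N}).

Definition tail_max T a : R := \big[Num.max/0]_(j < N | j \notin T) `|a j|.

(* The (m+1)-st largest of the |a j| (0 if N <= m), written as a min-max so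
   that its continuity in [a] is evident. *)
Definition threshold (m : nat) a : R :=
  \big[Num.min/tail_max finset.set0 a]_(T : {set 'I_N} | (#|T| <= m)%N)
     tail_max T a.

Definition clip (t x : R) : R := Num.max (- t) (Num.min t x).

(** Subtracting the clipped value, instead of zeroing the small entries, avoids a jump when an entry
    crosses the threshold. *)
Definition soft (m : nat) a (j : nat) : R := a j - clip (threshold m a) (a j).

Lemma tail_max_ge0 T a : 0 <= tail_max T a.
Proof. exact: bigmax_ge_id. Qed.

Lemma threshold_ge0 m a : 0 <= threshold m a.
Proof. by apply: le_bigmin => [|T _]; exact: tail_max_ge0. Qed.

(** The empty set is admissible and its [tail_max] dominates all others, so the default value of the
    minimum is harmless and some admissible [T] attains it. *)
Lemma threshold_attained m a :
  exists2 T : {set 'I_N}, (#|T| <= m)%N &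
    forall j : 'I_N, j \notin T -> `|a j| <= threshold m a.
Proof.
have [| T _|T Tm eT] := @eq_bigmin _ _ _ (tail_max finset.set0 a) finset.set0
    (fun T : {set 'I_N} => (#|T| <= m)%N) (tail_max ^~ a).
- by rewrite cards0.
- apply/bigmax_leP; split; first exact: tail_max_ge0.
  by move=> j _; apply: le_bigmax_cond; rewrite finset.in_set0.
- exists T => // j jT; rewrite /threshold eT.
  exact: (le_bigmax_cond _ (fun j : 'I_N => `|a j|)).
Qed.

(** Otherwise the entries reaching the threshold would form an admissible [T] with a strictly
    smaller [tail_max]. Positivity keeps the default value 0 of that maximum strictly below too. *)
Lemma threshold_count m a : 0 < threshold m a ->
  (m < #|[set j : 'I_N | (threshold m a <= `|a j|)%R]%SET|)%N.
Proof.
move=> t0; rewrite ltnNge; apply/negP => le_m.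
have := @bigmin_le_cond _ _ _ (tail_max finset.set0 a) _
  (fun T : {set 'I_N} => (#|T| <= m)%N) (tail_max ^~ a) le_m.
rewrite -/(threshold m a) leNgt => /negP; apply.
by apply/bigmax_ltP; split => // j; rewrite finset.inE -ltNge.
Qed.

Lemma clip_le (t x : R) : 0 <= t -> `|clip t x| <= t.
Proof.
by move=> t0; rewrite ler_norml /clip le_max lexx /= ge_max ge_min lexx andbT
  (le_trans _ t0)// oppr_le0.
Qed.

Lemma clip_le_norm (t x : R) : 0 <= t -> `|clip t x| <= `|x|.
Proof.
move=> t0; rewrite /clip; case: (leP t x) => tx.
  rewrite max_r; last by rewrite (le_trans _ t0)// oppr_le0.
  by rewrite !ger0_norm// (le_trans t0).
case: (leP (- t) x) => // xt.
by rewrite normrN ger0_norm// ler0_norm; lra.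
Qed.

Lemma clip_id (t x : R) : `|x| <= t -> clip t x = x.
Proof. by rewrite ler_norml /clip => /andP[? ?]; rewrite min_r// max_r. Qed.

Lemma card_soft_support m a :
  (#|[set j : 'I_N | (soft m a j != 0)%R]%SET| <= m)%N.
Proof.
have [T Tm aT] := threshold_attained m a.
apply: leq_trans Tm; apply/subset_leq_card/fintype.subsetP => j.
by rewrite finset.inE; apply: contraNT => /aT aj; rewrite /soft clip_id ?subrr.
Qed.

(* With m = 2n, at least n + 1 of the coordinates outside I are at least the
   threshold t, so that the n t^2 lost on I is paid for outside I. *)
Lemma soft_error n a (I : {set 'I_N}) : (#|I| <= n)%N ->
  \sum_(j < N) (a j - soft (2 * n) a j) ^+ 2
    <= 2 * \sum_(j < N | j \notin I) a j ^+ 2.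
Proof.
move=> In; set t := threshold (2 * n) a.
have t0 : 0 <= t by exact: threshold_ge0.
have sqr_le (x y : R) : `|x| <= `|y| -> x ^+ 2 <= y ^+ 2.
  by move=> xy; rewrite -(real_normK (num_real x)) -(real_normK (num_real y))
    lerXn2r ?nnegrE.
have E j : a j - soft (2 * n) a j = clip t (a j) by rewrite /soft -/t; ring.
(* One copy of the tail sum pays for the coordinates in [I], the other for those outside, where
   clipping never increases an absolute value. *)
rewrite (bigID (mem I)) /= mulr_natl mulr2n lerD//; last first.
  by apply: ler_sum => j _; rewrite E; apply/sqr_le/clip_le_norm.
apply: (@le_trans _ _ (n%:R * t ^+ 2)).
  apply: (@le_trans _ _ (\sum_(j in I) t ^+ 2)).
    apply: ler_sum => j _; rewrite E; apply: sqr_le.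
    by rewrite (ger0_norm t0) clip_le.
  by rewrite sumr_const -[leLHS]mulr_natl ler_wpM2r ?sqr_ge0 // ler_nat.
have [/threshold_count | ->] : 0 < t \/ t = 0.
- by move: t0; rewrite le_eqVlt => /orP[/eqP<-|]; [right|left].
- rewrite -/t; set J := [set j | _]%SET => Jn.
  have JI : (n <= #|J :\: I|)%N.
    have cJI : (#|J :&: I| <= n)%N.
      exact: leq_trans (subset_leq_card (finset.subsetIr J I)) In.
    move: Jn; rewrite -(cardsID I J) => Jn.
    by rewrite -(leq_add2l n) addnn -mul2n (leq_trans (ltnW Jn))// leq_add2r.
  apply: (@le_trans _ _ (\sum_(j in J :\: I) t ^+ 2)).
    by rewrite sumr_const -[leRHS]mulr_natl ler_wpM2r ?sqr_ge0 // ler_nat.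
  apply: (@le_trans _ _ (\sum_(j in J :\: I) a j ^+ 2)).
    apply: ler_sum => j; rewrite !finset.inE => /andP[_ tj].
    by apply: sqr_le; rewrite (ger0_norm t0).
  rewrite [leRHS](bigID (mem J)) /= -[leLHS]addr0 lerD//.
    rewrite le_eqVlt; apply/orP; left; apply/eqP/eq_bigl => j.
    by rewrite !finset.inE.
  by apply: sumr_ge0 => j _; rewrite sqr_ge0.
- by rewrite expr0n /= mulr0 sumr_ge0// => j _; rewrite sqr_ge0.
Qed.

Lemma continuous_soft (X : topologicalType) m (a : X -> nat -> R) :
  (forall j, continuous (fun x => a x j)) ->
  forall j, continuous (fun x => soft m (a x) j).
Proof.
move=> ca.
have cmax (Y : topologicalType) (f g : Y -> R) : continuous f -> continuous g ->
    continuous (fun y => Num.max (f y) (g y)).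
  by move=> cf cg y; exact: (continuous_max (cf y) (cg y)).
have cmin (Y : topologicalType) (f g : Y -> R) : continuous f -> continuous g ->
    continuous (fun y => Num.min (f y) (g y)).
  by move=> cf cg y; exact: (continuous_min (cf y) (cg y)).
have ctail T : continuous (fun x => tail_max T (a x)).
  apply: continuous_big => [|j _].
    by apply: cmax => y; [exact: cvg_fst|exact: cvg_snd].
  by move=> x; apply: cvg_norm; exact: ca.
have ct : continuous (fun x => threshold m (a x)).
  (* The default value of this minimum depends on [x] as well, so the induction runs over the list
     of index sets with that value as base case. *)
  rewrite /threshold; elim: (index_enum _) => [|T r IH].
    rewrite (_ : (fun x => _) = fun x => tail_max finset.set0 (a x)) //.
    by apply/funext => x; rewrite big_nil.
  pose f T x := tail_max T (a x).
  case Tm : (#|T| <= m)%N.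
    rewrite (_ : (fun x => _) = fun x => Num.min (f T x)
        (\big[Num.min/f finset.set0 x]_(U <- r | (#|U| <= m)%N) f U x)).
      by apply: cmin => //; exact: ctail.
    by apply/funext => x; rewrite big_cons Tm.
  rewrite (_ : (fun x => _) = fun x =>
      \big[Num.min/f finset.set0 x]_(U <- r | (#|U| <= m)%N) f U x) //.
  by apply/funext => x; rewrite big_cons Tm.
move=> j; have cclip : continuous (fun x => clip (threshold m (a x)) (a x j)).
  apply: cmax; last by apply: cmin => //; exact: ca.
  by move=> x; apply: cvgN; exact: ct.
by move=> x; apply: cvgB; [exact: ca|exact: cclip].
Qed.

End Threshold.

(** * Extension of real Lipschitz functions *)

Lemma lipschitz_extension (R : realType) (V : normedModType R) (T : Type)
    (A : set T) (L : T -> V) (g : T -> R) (D : R) :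
  A !=set0 -> 0 <= D ->
  (forall s t, A s -> A t -> `|g s - g t| <= D * `|L s - L t|) ->
  exists2 phi : V -> R, continuous phi & forall s, A s -> phi (L s) = g s.
Proof.
move=> A0 D0 gL.
(* McShane extension: the infimum of the cones with slope [D] and apexes at the points [L s]. *)
pose E x := [set g s + D * `|x - L s| | s in A].
have E0 x : E x !=set0 by case: A0 => s As; exists (g s + D * `|x - L s|), s.
(* This bound makes every infimum finite and, at [x = L s], shows that the extension is at least
   [g s]. *)
have lbE s x : A s -> lbound (E x) (g s - D * `|x - L s|).
  move=> As _ [t At <-]; rewrite lerBlDr -addrA -mulrDr -lerBlDl.
  apply: le_trans (ler_norm _) _; apply: le_trans (gL _ _ As At) _.
  rewrite ler_wpM2l// -[X in `|X - _| <= _](subrK x) -addrA (distrC x (L s)) [leRHS]addrC.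
  exact: ler_normD.
have hE x : has_lbound (E x).
  by case: A0 => s As; exists (g s - D * `|x - L s|); exact: lbE.
have lip x y : inf (E x) - inf (E y) <= D * `|x - y|.
  rewrite lerBlDr -lerBlDl; apply: lb_le_inf => // _ [s As <-].
  rewrite lerBlDl; apply: (@le_trans _ _ (g s + D * `|x - L s|)).
    by apply: ge_inf => //; exists s.
  rewrite addrCA lerD2l -mulrDr ler_wpM2l// -[X in `|X - _| <= _](subrK y) -addrA.
  exact: ler_normD.
exists (fun x => inf (E x)).
  move=> x; apply/cvgrPdist_lt => e e0; near=> y.
  apply: (@le_lt_trans _ _ (D * `|x - y|)).
    by rewrite ler_norml lip andbT lerNl opprB distrC lip.
  (* [D] may be 0, so the division below is by [D + 1]. *)
  apply: (@le_lt_trans _ _ ((D + 1) * `|x - y|)).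
    by rewrite ler_wpM2r// lerDl.
  rewrite -ltr_pdivlMl ?ltr_wpDl//.
  near: y; apply: cvgr_dist_lt; first exact: cvg_id.
  by rewrite mulr_gt0// invr_gt0 ltr_wpDl.
move=> s As; apply/eqP; rewrite eq_le; apply/andP; split.
  by apply: ge_inf => //; exists s => //; rewrite subrr normr0 mulr0 addr0.
apply: lb_le_inf => // r Er.
by have := lbE s (L s) As r Er; rewrite subrr normr0 mulr0 subr0.
Unshelve. all: by end_near. Qed.

(** * Recovery of sparse vectors from power moments *)

Section SparseVectors.
Variables (R : realType) (N M : nat).
Implicit Types z y : nat -> R.

Definition support_size z := #|[set j : 'I_N | (z j != 0)%R]%SET|.

Definition moments z : 'rV[R]_M :=
  \sum_(j < N) z j *: \row_(i < M) j%:R ^+ i.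

Lemma ler_norm_coord (v : 'rV[R]_M) i : `|v 0 i| <= `|v|.
Proof.
rewrite [leRHS]mx_normrE.
exact: (@le_bigmax _ _ _ 0 (fun ij : 'I_1 * 'I_M => `|v ij.1 ij.2|) (0, i)).
Qed.

(* Vandermonde: to isolate z k, test the moments against the polynomial
   vanishing at the other nodes of the support of z. *)
Lemma moments_lower_bound : exists2 D : R, 0 <= D &
  forall z, (support_size z <= M)%N ->
  forall k : 'I_N, `|z k| <= D * `|moments z|.
Proof.
pose p (T : {set 'I_N}) (k : 'I_N) : {poly R} :=
  \prod_(j in (T :\ k)%SET) ('X - (j%:R)%:P).
pose d (T : {set 'I_N}) (k : 'I_N) : R :=
  (\sum_(i < M) `|(p T k)`_i|) / `|(p T k).[k%:R]|.
have d0 T k : 0 <= d T k by rewrite divr_ge0// sumr_ge0.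
(* Summing over the finitely many supports and indices yields one constant for all [z]. *)
exists (\sum_T \sum_k d T k).
  by apply: sumr_ge0 => T _; apply: sumr_ge0.
move=> z; rewrite /support_size; set T := [set j | _]%SET => TM k.
have [->|zk0] := eqVneq (z k) 0.
  rewrite normr0 mulr_ge0//.
  by apply: sumr_ge0 => U _; apply: sumr_ge0.
have kT : k \in T by rewrite finset.inE.
have pk0 : (p T k).[k%:R] != 0.
  rewrite horner_prod prodf_seq_neq0; apply/allP => j _; apply/implyP.
  rewrite !finset.inE => /andP[jk _]; rewrite hornerXsubC subr_eq0 eqr_nat.
  by rewrite eq_sym.
(* The product has one linear factor fewer than [T] has elements, hence size [#|T|], and [M] moments
   reach all its coefficients. *)
have size_p : (size (p T k) <= M)%N.
  rewrite /p -big_enum size_prod_XsubC -cardE.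
  by move: TM; rewrite (cardsD1 k) kT.
have key : z k * (p T k).[k%:R] = \sum_(i < M) (p T k)`_i * moments z 0 i.
  transitivity (\sum_(j < N) z j * (p T k).[j%:R]).
    rewrite (bigD1 k)//= big1 ?addr0// => j jk.
    have [->|zj0] := eqVneq (z j) 0; first by rewrite mul0r.
    suff -> : (p T k).[j%:R] = 0 by rewrite mulr0.
    apply/eqP; rewrite horner_prod; apply/prodf_eq0; exists j.
      by rewrite !finset.inE jk.
    by rewrite hornerXsubC subrr.
  under eq_bigr do rewrite (horner_coef_wide _ size_p) mulr_sumr.
  rewrite exchange_big; apply: eq_bigr => i _ /=.
  rewrite summxE mulr_sumr; apply: eq_bigr => j _.
  by rewrite !mxE mulrCA.
apply: (@le_trans _ _ (d T k * `|moments z|)); last first.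
  rewrite ler_wpM2r//.
  rewrite (bigD1 T)//= (bigD1 k)//= -addrA lerDl.
  by apply: addr_ge0; apply: sumr_ge0 => // U _; apply: sumr_ge0.
rewrite /d mulrAC ler_pdivlMr ?normr_gt0// -normrM key mulr_suml.
apply: le_trans (ler_norm_sum _ _ _) _; apply: ler_sum => i _.
by rewrite normrM ler_wpM2l// ler_norm_coord.
Qed.

(** Differences of [m]-sparse vectors are [2 * m]-sparse, so on sparse vectors each coordinate is a
    Lipschitz function of the moments. The coordinates are extended one at a time, which needs only
    the scalar extension. *)
Lemma moments_decoder (m : nat) : (2 * m <= M)%N ->
  exists2 psi : 'rV[R]_M -> nat -> R,
    forall j, continuous (fun x => psi x j) &
    forall y, (support_size y <= m)%N ->
      forall j : 'I_N, psi (moments y) j = y j.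
Proof.
move=> mM; have [D D0 HD] := moments_lower_bound.
pose A := [set y | (support_size y <= m)%N].
have A0 : A !=set0.
  exists (fun=> 0); rewrite /A /= /support_size.
  rewrite (_ : finset _ = finset.set0) ?cards0//.
  by apply/setP => j; rewrite !finset.inE eqxx.
have momentsB y z : moments (fun j => y j - z j) = moments y - moments z.
  by rewrite /moments -sumrB; apply: eq_bigr => j _; rewrite scalerBl.
have /choice[f Hf] : forall j : nat, exists f : 'rV[R]_M -> R,
    continuous f /\ forall y, A y -> (j < N)%N -> f (moments y) = y j.
  move=> j; have [jN|jN] := ltnP j N; last first.
    by exists (fun=> 0); split => //; exact: (@cst_continuous _ _ (0 : R)).
  have [|f cf Hf] := @lipschitz_extension _ _ _ A moments (fun y => y j) D A0 D0.
    move=> y z Ay Az; rewrite -momentsB.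
    apply: (HD (fun i => y i - z i) _ (Ordinal jN)).
    apply: leq_trans mM; rewrite mul2n -addnn.
    apply: leq_trans (leq_add Ay Az); apply: leq_trans (leq_card_setU _ _).
    apply/subset_leq_card/fintype.subsetP => i; rewrite !finset.inE.
    by apply: contraNT; rewrite negb_or !negbK => /andP[/eqP-> /eqP->]; rewrite subrr.
  by exists f; split => // y Ay _; exact: Hf.
exists (fun x j => f j x) => [j|y Ay j]; first exact: (Hf j).1.
exact: (Hf j).2.
Qed.

Lemma continuous_moments (X : topologicalType) (a : X -> nat -> R) :
  (forall j, continuous (fun x => a x j)) -> continuous (fun x => moments (a x)).
Proof.
move=> ca; apply: continuous_big => [|j _ x]; first exact: add_continuous.
by apply: cvgZr_tmp; exact: ca.
Qed.

End SparseVectors.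

(** * Continuous coefficients and thresholding for Riesz bases *)

Section RieszSequences.
Variables (R : realType) (H : normedModType R) (h : nat -> H).
Implicit Types (a b : nat -> R) (u : H).

Lemma lincombB N a b :
  lincomb h N (fun j => a j - b j) = lincomb h N a - lincomb h N b.
Proof. by rewrite /lincomb -sumrB; apply: eq_bigr => j _; rewrite scalerBl. Qed.

Lemma lincomb_widen N N' a : (N <= N')%N ->
  lincomb h N' (fun j => if (j < N)%N then a j else 0) = lincomb h N a.
Proof.
move=> NN'; rewrite /lincomb (big_ord_widen _ (fun j => a j *: h j) NN').
rewrite [RHS]big_mkcond; apply: eq_bigr => j _ /=.
by case: ifP => // _; rewrite scale0r.
Qed.

Lemma continuous_lincomb (X : topologicalType) N (a : X -> nat -> R) :
  (forall j, continuous (fun x => a x j)) ->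
  continuous (fun x => lincomb h N (a x)).
Proof.
move=> ca; apply: continuous_big => [|j _ x]; first exact: add_continuous.
by apply: cvgZr_tmp; exact: ca.
Qed.

(* Schauder projection onto a finite net contained in the span of h, with
   normalisation bounded below so as to be continuous on all of H. *)
Lemma continuous_approx_coefs (K : set H) (e : R) :
  complete_seq h -> compact K -> 0 < e ->
  exists N (a : H -> nat -> R), (forall j, continuous (fun u => a u j)) /\
    forall u, K u -> `|u - lincomb h N (a u)| <= e.
Proof.
move=> hc Kc e0.
pose D := [set v | exists N b, v = lincomb h N b].
have e20 : 0 < e / 2 by rewrite divr_gt0.
have cK : cover_compact K by rewrite -compact_cover.
have [|u _|F FD KF] := cK H D (fun v => ball v (e / 2)).
- by move=> v _; exact: ball_open.
- have : closure D u by rewrite (hc : closure D = _).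
  move=> /(_ _ (nbhsx_ballx u _ e20))[v [Dv uv]].
  by exists v => //; exact: ball_sym.
have /choice[P HP] : forall v, exists p : nat * (nat -> R),
    D v -> v = lincomb h p.1 p.2.
  move=> v; have [[N [b ->]]|nD] := pselect (D v); first by exists (N, b).
  by exists (0%N, fun=> 0).
pose r : seq H := finmap.enum_fset F.
pose N := (\max_(v <- r) (P v).1)%N.
(* The expansions of the net points are padded with zeros to the common length [N]. *)
pose c v j := if (j < (P v).1)%N then (P v).2 j else 0.
have cE v : v \in r -> lincomb h N (c v) = v.
  move=> vF; rewrite lincomb_widen; last exact: leq_bigmax_seq.
  by apply/esym/HP; have := FD _ vF; rewrite inE.
pose w v u := Num.max 0 (e - `|u - v|).
have w0 v u : 0 <= w v u by rewrite le_max lexx.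
pose sw u := \sum_(v <- r) w v u.
pose W u := Num.max (e / 2) (sw u).
have W0 u : 0 < W u by rewrite lt_max e20.
have cw v : continuous (w v).
  move=> u; apply: (@continuous_max _ _ (fun=> 0) (fun u => e - `|u - v|)).
    exact: cvg_cst.
  apply: cvgB; first exact: cvg_cst.
  by apply: cvg_norm; apply: cvgB; [exact: cvg_id|exact: cvg_cst].
exists N, (fun u j => (\sum_(v <- r) w v u * c v j) / W u); split.
  have cW : continuous W.
    move=> u; apply: (@continuous_max _ _ (fun=> e / 2) sw); first exact: cvg_cst.
    by apply: continuous_big; [exact: add_continuous|move=> v _; exact: cw].
  move=> j; have cn : continuous (fun u => \sum_(v <- r) w v u * c v j).
    apply: continuous_big => [|v _ u]; first exact: add_continuous.
    by apply: cvgM; [exact: cw|exact: cvg_cst].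
  by move=> u; apply: cvgM; [exact: cn|apply: cvgV; [rewrite gt_eqF|exact: cW]].
move=> u Ku; have [v0 v0F /= uv0] := KF _ Ku.
(* On [K] some net point lies within [e / 2] and alone has weight at least [e / 2], so the maximum
   is the true sum of weights. *)
have WE : W u = sw u.
  rewrite /W max_r// /sw (big_rem _ v0F)/= -[leLHS]addr0 lerD ?sumr_ge0//.
  rewrite le_max; apply/orP; right.
  move: uv0; rewrite -ball_normE /= distrC; lra.
have -> : lincomb h N (fun j => (\sum_(v <- r) w v u * c v j) / W u)
    = (W u)^-1 *: \sum_(v <- r) w v u *: v.
  rewrite /lincomb.
  under eq_bigr do rewrite mulrC -scalerA scaler_suml.
  rewrite -scaler_sumr exchange_big; congr (_ *: _).
  rewrite big_seq_cond [RHS]big_seq_cond; apply: eq_bigr => v /andP[vF _].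
  rewrite -[X in _ = _ *: X](cE v vF) /lincomb scaler_sumr; apply: eq_bigr => j _.
  by rewrite scalerA.
have -> : u - (W u)^-1 *: \sum_(v <- r) w v u *: v
    = (W u)^-1 *: \sum_(v <- r) w v u *: (u - v).
  under [in RHS]eq_bigr do rewrite scalerBr.
  by rewrite sumrB scalerBr -scaler_suml -/(sw u) -WE scalerA mulVf ?gt_eqF// scale1r.
rewrite normrZ gtr0_norm ?invr_gt0// ler_pdivrMl// WE mulr_suml.
apply: le_trans (ler_norm_sum _ _ _) _; apply: ler_sum => v _.
rewrite normrZ ger0_norm//.
(* Only net points at distance less than [e] carry weight. *)
have [->|wv0] := eqVneq (w v u) 0; first by rewrite !mul0r.
rewrite ler_wpM2l//; move: wv0; rewrite /w.
by case: (ltP 0 (e - `|u - v|)) => [|_ /eqP//]; lra.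
Qed.

Lemma riesz_bounds (C : R) : riesz_C C h -> exists A B : R,
  [/\ 0 < A, 0 <= B, B <= C * A & forall N a,
     A * l2fin N a <= `|lincomb h N a| /\ `|lincomb h N a| <= B * l2fin N a].
Proof.
move=> [[_ A0 Boo] BAC].
(* The ratio of [h 0] alone lies between the optimal constants, which forces both to be finite. *)
pose r0 := (`|lincomb h 1 (fun=> 1)| / l2fin 1 (fun=> 1 : R))%:E.
have Er : riesz_ratios h r0.
  by exists 1%N, (fun=> 1); split => //; exists 0%N => //; exact: oner_neq0.
have Ar : (riesz_A h <= r0)%E by exact: ereal_inf_lbound.
have Br : (r0 <= riesz_B h)%E by exact: ereal_sup_ubound.
have Afin : riesz_A h \is a fin_num.
  by rewrite gt0_fin_numE// (le_lt_trans Ar)// ltry.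
have Bfin : riesz_B h \is a fin_num.
  by rewrite gt0_fin_numE// (lt_le_trans A0)// (le_trans Ar).
have A0' : 0 < fine (riesz_A h) by rewrite fine_gt0// A0 -ge0_fin_numE ?ltW.
exists (fine (riesz_A h)), (fine (riesz_B h)); split => //.
- by rewrite fine_ge0// (le_trans _ Br)// (le_trans _ Ar)// ltW.
- by rewrite -ler_pdivrMr.
move=> N a; have [/existsP[k ak]|/existsPn a0] :=
    boolP [exists k : 'I_N, a k != 0].
  have l0 : 0 < l2fin N a.
    rewrite sqrtr_gt0 (bigD1 k)//= ltr_pwDl ?exprn_even_gt0//.
    by apply: sumr_ge0 => j _; rewrite sqr_ge0.
  have Ea : riesz_ratios h (`|lincomb h N a| / l2fin N a)%:E.
    by exists N, a; split => //; exists k.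
  split; [rewrite -ler_pdivlMr//|rewrite -ler_pdivrMr//]; rewrite -lee_fin fineK//.
    exact: ereal_inf_lbound.
  exact: ereal_sup_ubound.
have a0' (j : 'I_N) : a j = 0 by apply/eqP; have := a0 j; rewrite negbK.
rewrite /l2fin /lincomb !big1 => [|j _|j _]; rewrite ?a0' ?scale0r ?expr0n//.
by rewrite sqrtr0 normr0 !mulr0.
Qed.

(** Both [lincomb h N a] and the [n]-term sum are close to [u], so the lower Riesz bound controls
    their coefficient difference [b]. Off the indices [i], [a] agrees with [b]; hence [soft_error]
    bounds the thresholding loss by the norm of [b], and the upper Riesz bound returns to [H]. *)
Lemma soft_approx (A B C e s : R) N n (a : nat -> R) u
    (i : 'I_n -> nat) (c : 'I_n -> R) :
  0 < A -> 0 <= B -> B <= C * A ->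
  (forall N b, A * l2fin N b <= `|lincomb h N b| /\
               `|lincomb h N b| <= B * l2fin N b) ->
  `|u - lincomb h N a| <= e -> `|u - \sum_(k < n) c k *: h (i k)| <= s ->
  `|u - lincomb h N (soft R N (2 * n) a)| <= e + 2 * C * (s + e).
Proof.
move=> A0 B0 BC AB ue us.
pose I := [set j : 'I_N | nat_of_ord j \in codom i]%SET.
have In : (#|I| <= n)%N.
  rewrite cardE -(size_map val) -[n in leqRHS]card_ord -(size_codom i).
  apply: uniq_leq_size; first by rewrite (map_inj_uniq val_inj) enum_uniq.
  by move=> _ /mapP[j + ->]; rewrite mem_enum finset.inE.
(* The [n]-term sum may use basis elements beyond the first [N]. *)
pose N' := maxn N (\max_(k < n) (i k).+1).
have NN' : (N <= N')%N by exact: leq_maxl.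
have iN' k : (i k < N')%N.
  by rewrite leq_max; apply/orP; right; exact: (leq_bigmax k).
(* The indices [i k] may repeat, so the coefficients falling on the same [j] are added. *)
pose b j := (if (j < N)%N then a j else 0) -
            \sum_(k < n) (if i k == j then c k else 0).
have bE : lincomb h N' b = lincomb h N a - \sum_(k < n) c k *: h (i k).
  rewrite lincombB lincomb_widen//; congr (_ - _).
  rewrite /lincomb; under eq_bigr do rewrite scaler_suml.
  rewrite exchange_big; apply: eq_bigr => k _.
  rewrite (bigD1 (Ordinal (iN' k)))//= eqxx big1 ?addr0// => j jk.
  case: eqP => [ij|_]; last by rewrite scale0r.
  by case/eqP: jk; apply/val_inj.
have bn : A * l2fin N' b <= s + e.
  apply: le_trans (AB N' b).1 _; rewrite bE.
  rewrite -[X in `|X|](subrKA u) addrC; apply: le_trans (ler_normD _ _) _.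
  by rewrite lerD// distrC.
have ab : \sum_(j < N | j \notin I) a j ^+ 2 <= \sum_(j < N') b j ^+ 2.
  under eq_bigl do rewrite finset.inE.
  rewrite (big_ord_widen_cond _ (fun j => j \notin codom i) (fun j => a j ^+ 2) NN').
  rewrite big_mkcond; apply: ler_sum => j _ /=; case: ifP => [/andP[ji jN]|_].
    rewrite /b jN big1 ?subr0// => k _; case: eqP => // ij.
    by move: ji; rewrite -ij codom_f.
  exact: sqr_ge0.
set y := soft R N (2 * n) a.
(* The factor sqrt 2 from [soft_error] is rounded up to 2. *)
have ay : l2fin N (fun j => a j - y j) <= 2 * l2fin N' b.
  rewrite -ler_sqr ?nnegrE ?mulr_ge0 ?sqrtr_ge0// exprMn /l2fin.
  rewrite !sqr_sqrtr; try by apply: sumr_ge0 => j _; rewrite sqr_ge0.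
  apply: le_trans (soft_error _ _ n a I In) _.
  have b0 : 0 <= \sum_(j < N') b j ^+ 2 by apply: sumr_ge0 => j _; rewrite sqr_ge0.
  by rewrite expr2; move: ab b0; lra.
rewrite -[X in `|X|](subrKA (lincomb h N a)).
apply: le_trans (ler_normD _ _) _; rewrite lerD// -lincombB.
apply: le_trans (AB N _).2 _.
apply: le_trans (ler_wpM2l B0 ay) _.
apply: (@le_trans _ _ (C * A * (2 * l2fin N' b))).
  by rewrite ler_wpM2r// mulr_ge0// sqrtr_ge0.
have C0 : 0 <= C by rewrite -(pmulr_lge0 _ A0) (le_trans B0).
have := ler_wpM2l C0 bn; nra.
Qed.

End RieszSequences.

(** * Comparison of manifold and nonlinear widths *)

Section ManifoldWidths.
Variables (R : realType) (G H : normedModType R).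
Variables (S : {linear G -> H}) (Fs : set G) (q : G -> R).
Hypotheses (Scont : continuous S) (hF : quasi_normed_subspace Fs q).

Lemma unit_ballF0 : unit_ballF Fs q 0.
Proof.
have [F0 [_ [_ [_ [_ [qZ _]]]]]] := hF.
by split => //; rewrite -(scale0r 0) qZ// normr0 mul0r ler01.
Qed.

Lemma sigma_n_ge0 n u (h : nat -> H) : (0 <= sigma_n n u h)%E.
Proof. by apply: le_ereal_inf_tmp => _ [i [c ->]]; rewrite lee_fin. Qed.

(** The point 0 of the unit ball keeps this supremum from being that of an empty set, minus
    infinity. *)
Lemma worst_sigma_n_ge0 n (h : nat -> H) :
  (0 <= ereal_sup [set sigma_n n (S f) h | f in unit_ballF Fs q])%E.
Proof.
apply: le_trans (sigma_n_ge0 n (S 0) h) _; apply: ereal_sup_ubound.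
by exists 0 => //; exact: unit_ballF0.
Qed.

Lemma e_non_ge0 n C : (0 <= e_non Fs q S n C)%E.
Proof. by apply: le_ereal_inf_tmp => _ [h _ <-]; exact: worst_sigma_n_ge0. Qed.

Hypothesis hcpt : compact_embedding Fs q.

(** Compact sets are bounded, and homogeneity of [q] carries the bound from the unit ball to [Fs].
    This turns continuity on [G] into continuity for [q]. *)
Lemma embedding_bounded : exists2 M : R, 0 < M &
  forall f, Fs f -> `|f| <= M * q f.
Proof.
have [_ [_ [FZ [q0 [q_eq0 [qZ _]]]]]] := hF.
have [M0 [_ HM0]] := compact_bounded hcpt.
pose M := M0 + 1.
have HM f : closure (unit_ballF Fs q) f -> `|f| <= M by apply: HM0; rewrite ltrDl.
exists (Num.max 1 M) => [|f Ff]; first by rewrite lt_max ltr01.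
have [qf0|qf0] := eqVneq (q f) 0; first by rewrite qf0 mulr0 (q_eq0 _ Ff qf0) normr0.
have qf : 0 < q f by rewrite lt_def qf0 q0.
have : closure (unit_ballF Fs q) ((q f)^-1 *: f).
  apply: subset_closure; split; first exact: FZ.
  by rewrite qZ// gtr0_norm ?invr_gt0// mulVf.
move/HM; rewrite normrZ gtr0_norm ?invr_gt0// ler_pdivrMl// => fM.
by rewrite (le_trans fM)// mulrC ler_wpM2r ?(ltW qf)// le_max lexx orbT.
Qed.

Lemma continuous_Fcontinuous m (N : G -> 'rV[R]_m) :
  continuous N -> Fcontinuous Fs q N.
Proof.
move=> cN f Ff e e0; have [M M0 HM] := embedding_bounded.
have [_ [FD [FZ _]]] := hF.
have /cvgrPdist_lt/(_ _ e0)/nbhs_ballP[d /= d0 Hd] := cN f.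
exists (d / M) => [|g Fg]; first by rewrite divr_gt0.
rewrite ltr_pdivlMr// mulrC => gfd; rewrite distrC; apply: Hd.
rewrite -ball_normE /= distrC (le_lt_trans _ gfd)//; apply: HM.
by apply: FD => //; rewrite -scaleN1r; exact: FZ.
Qed.

Lemma e_cont_le_riesz C n (h : nat -> H) : 1 <= C -> riesz_C C h ->
  (e_cont Fs q S (4 * n + 1)
    <= (2 * C)%:E *
       ereal_sup [set sigma_n n (S f) h | f in unit_ballF Fs q])%E.
Proof.
move=> C1 hC; have C0 : 0 < C by exact: lt_le_trans ltr01 C1.
have := worst_sigma_n_ge0 n h; set s := ereal_sup _.
have sE f : unit_ballF Fs q f -> (sigma_n n (S f) h <= s)%E.
  by move=> ff; apply: ereal_sup_ubound; exists f.
move: s sE => [s|_ _|//]; last by rewrite gt0_muley ?leey// lte_fin mulr_gt0.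
move=> sE _; apply/lee_addgt0Pr => e' e'0.
(* The final error is [e + 2 * C * ((s + e) + e)], that is [2 * C * s + (1 + 4 * C) * e]. *)
pose e := e' / (1 + 4 * C).
have C4 : 0 < 1 + 4 * C by rewrite ltr_pwDl// mulr_ge0// ltW.
have e0 : 0 < e by rewrite divr_gt0.
have [A [B [A0 B0 BC AB]]] := riesz_bounds _ _ _ _ hC.
pose K := [set S f | f in closure (unit_ballF Fs q)].
have Kc : compact K.
  by apply: continuous_compact => //; exact: continuous_subspaceT.
have [[hc _ _] _] := hC.
have [N [a [ca aK]]] := continuous_approx_coefs _ _ _ K e hc Kc e0.
have m4 : (2 * (2 * n) <= 4 * n + 1)%N by lia.
have [psi cpsi psiK] := moments_decoder R N (4 * n + 1) (2 * n) m4.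
pose y f := soft R N (2 * n) (a (S f)).
pose enc f := moments R N (4 * n + 1) (y f).
pose dec x := lincomb h N (psi x).
have cy j : continuous (fun f => y f j).
  apply: continuous_soft => {}j f.
  by apply: (@continuous_comp _ _ _ S (fun u => a u j)); [exact: Scont|exact: ca].
have cdec : continuous dec. by exact: continuous_lincomb.
apply: (@le_trans _ _ (err Fs q S (dec \o enc))).
  apply: ereal_inf_lbound; exists enc, dec; split => //.
  by apply: continuous_Fcontinuous; exact: continuous_moments.
apply: ge_ereal_sup => _ [f ff <-]; rewrite -EFinM -EFinD lee_fin.
(* Decoding is exact because [y f] is [2 * n]-sparse. *)
have decE : dec (enc f) = lincomb h N (y f).
  apply: eq_bigr => j _; congr (_ *: _); apply: psiK.
  exact: card_soft_support.
(* The infimum in [sigma_n] need not be attained; the slack [e] provides an actual [n]-term sum. *)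
have : (sigma_n n (S f) h < (s + e)%:E)%E.
  by rewrite (le_lt_trans (sE f ff))// lte_fin ltrDl.
move=> /ereal_inf_lt[_ [i [c ->]]]; rewrite lte_fin => /ltW fs.
have aS : `|S f - lincomb h N (a (S f))| <= e.
  by apply: aK; exists f => //; exact: subset_closure.
have := soft_approx _ _ _ _ _ _ _ _ _ _ _ _ _ _ A0 B0 BC AB aS fs.
rewrite /= decE => /le_trans; apply.
have -> : e' = e * (1 + 4 * C) by rewrite /e divfK ?gt_eqF.
by rewrite le_eqVlt; apply/orP; left; apply/eqP; ring.
Qed.

Lemma e_cont_le_e_non C n : 1 <= C ->
  (e_cont Fs q S (4 * n + 1) <= (2 * C)%:E * e_non Fs q S n C)%E.
Proof.
move=> C1; have C2 : 0 < 2 * C by rewrite mulr_gt0// (lt_le_trans ltr01).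
rewrite -lee_pdivrMl//; apply: le_ereal_inf_tmp => _ [h hC <-].
by rewrite lee_pdivrMl//; exact: e_cont_le_riesz.
Qed.

End ManifoldWidths.

(** * Inserting the operator norms *)

Theorem theorem1 (R : realType) (G H : completeNormedModType R)
    (ipG : G -> G -> R) (ipH : H -> H -> R)
    (hipG : inner_product ipG) (hipH : inner_product ipH)
    (S : {linear G -> H}) (Sinv : H -> G)
    (SK : cancel S Sinv) (SinvK : cancel Sinv S)
    (Scont : continuous S) (Sinvcont : continuous Sinv)
    (Fs : set G) (q : G -> R)
    (hF : quasi_normed_subspace Fs q) (hcpt : compact_embedding Fs q)
    (C : R) (hC : 1 <= C) (n : nat) :
  (e_cont Fs q S (4 * n + 1)%N
   <= (2 * C)%:E * (op_norm S ^+ 2) * (op_norm Sinv ^+ 2) * e_non Fs q S n C)%E.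
Proof.
(* If [G = 0] the operator norms vanish and cannot be bounded below, but zero encoder and decoder
   already have error 0. *)
have [[x0 x00]|G0] := pselect (exists x : G, x != 0); last first.
  have {}G0 (x : G) : x = 0.
    by apply: contrapT => /eqP x0; apply: G0; exists x.
  apply: (@le_trans _ _ 0%E).
    apply: ge_ereal_inf.
    exists (err Fs q S ((fun=> 0) \o (fun=> 0 : 'rV[R]_(4 * n + 1)))).
      exists (fun=> 0), (fun=> 0); split => //.
        by move=> f _ e e0; exists 1 => // g _ _; rewrite subrr normr0.
      exact: cst_continuous.
    apply: ge_ereal_sup => _ [f _ <-].
    by rewrite /= (G0 f) linear0 subrr normr0.
  have on0 (V W : normedModType R) (T : V -> W) : (0 <= op_norm T)%E.
    apply: (@le_trans _ _ (`|T 0|)%:E); first by rewrite lee_fin.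
    by apply: ereal_sup_ubound; exists 0; rewrite //= normr0.
  rewrite !mule_ge0 ?expe_ge0//; last exact: e_non_ge0.
  by rewrite lee_fin mulr_ge0// (le_trans ler01).
apply: le_trans (e_cont_le_e_non _ _ _ _ _ _ Scont hF hcpt _ n hC) _.
apply: lee_wpmul2r; first exact: e_non_ge0.
(* A unit vector [x] gives norm at least [|S x|] for [S] and at least its inverse for [Sinv], so the
   two squared norms have product at least 1. *)
pose x := `|x0|^-1 *: x0.
have x1 : `|x| = 1 by rewrite normrZ normfV normr_id mulVf ?normr_eq0.
have Sx0 : 0 < `|S x|.
  rewrite normr_gt0; apply/eqP => Sx; have := SK x; rewrite Sx -(linear0 S) SK => x0'.
  by move: x1; rewrite -x0' normr0 => /eqP; rewrite eq_sym oner_eq0.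
have oS : ((`|S x|)%:E <= op_norm S)%E.
  by apply: ereal_sup_ubound; exists x; rewrite //= x1.
have oSinv : ((`|S x|^-1)%:E <= op_norm Sinv)%E.
  apply: ereal_sup_ubound; exists (`|S x|^-1 *: S x) => /=.
    by rewrite normrZ normfV normr_id mulVf ?gt_eqF.
  by rewrite -linearZ SK normrZ x1 mulr1 normfV normr_id.
rewrite -[leLHS]mule1 -muleA lee_wpmul2l//.
  by rewrite lee_fin mulr_ge0// (le_trans ler01).
have -> : (1 = (`|S x|%:E ^+ 2) * (`|S x|^-1%:E ^+ 2) :> \bar R)%E.
  by rewrite !expe2 -!EFinM; congr EFin; field; rewrite gt_eqF.
apply: lee_pmul; rewrite ?expe_ge0 ?lee_fin ?invr_ge0//.
  by rewrite !expe2; apply: lee_pmul; rewrite ?lee_fin.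
by rewrite !expe2; apply: lee_pmul; rewrite ?lee_fin ?invr_ge0.
Qed.
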